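(* Let $\mathcal{K}\subset E$ be a closed convex cone, let $c\in E$ be nonzero and such that there exists $x\in\mathcal{K}$ with $\langle c,x\rangle>0$, and let $\rho:E\to\mathbb{R}$ be a convex quartic form with $\alpha^2\|x\|^4\le\rho(x)\le\beta^2\|x\|^4$ for all $x\in E$, where $0<\alpha\le\beta$; put $\kappa=\beta/\alpha$. Let $f(x)=\rho(x)-\langle c,x\rangle$, let $x^*$ be a minimizer of $f$ over $\mathcal{K}$, and let $y^*$ be the solution of the homogenized problem of minimizing $\sqrt{\rho(y)}$ over $\{y\in\mathcal{K}:\langle c,y\rangle=1\}$. Then the accelerated homogenized gradient method (described in the context), initialized at $y_0\in E$, finds a point $x_T$ satisfying $$\frac{f(x_T)-f(x^* )}{|f(x^* )|}\le\delta$$ in at most $$\mathcal{O}\left(\frac{\sqrt{\kappa}}{\delta^{1/4}}\left(1+\delta_0^{1/4}\right)\right)$$ projected gradient steps, where $\delta_0=\sqrt{\frac{\rho(y_0)}{\rho(y^* )}}-1$.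
   Context: $E$ is a Euclidean space with canonical inner product $\langle\cdot,\cdot\rangle$, and $\|\cdot\|$ is a Euclidean norm $\|x\|=\langle Bx,x\rangle^{1/2}$ induced by a self-adjoint positive definite operator $B$. A convex quartic form is a convex function $\rho$ of the form $\rho(x)=Q[x,x,x,x]$, where $Q:E^4\to\mathbb{R}$ is $4$-linear and symmetric (invariant under permutations of its arguments). The number $\kappa$ is called the quartic condition number of $\rho$. Accelerated homogenized gradient method with $T$ outer iterations: initialize $y_0\in E$. For each outer iteration $t=0,1,\dots,T-1$, set $u^0=z^0=y_t$ and, for $k=0,1,\dots,2^t-1$, perform the projected gradient step $$u^{k+1}=\operatorname*{argmin}\left\{\frac{1}{2\sqrt{\rho(z^k)}}\langle\nabla\rho(z^k),y-z^k\rangle+3\beta\|y-z^k\|^2\ :\ y\in\mathcal{K},\ \langle c,y\rangle=1\right\}$$ and set $z^{k+1}=u^{k+1}+\frac{k}{k+3}(u^{k+1}-u^k)$; then let $y_{t+1}$ be a point of $\{y_t,\,u^{2^t}\}$ with the smallest value of $\rho$. Return $x_T=y_T/(4\rho(y_T))^{1/3}$.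
   Formalization: The starting point y_0 is required to be feasible for the homogenized problem (y_0 in K and <c,y_0> = 1) instead of arbitrary in E; for an infeasible y_0 (e.g. K = R^2, rho = |x|^4, c = e_1, y_0 = e_2) the method may never leave y_0 and the claim fails. *)

(* Defs.v *)
From HB Require Import structures.
From mathcomp Require Import all_boot all_order all_algebra all_fingroup.
From mathcomp Require Import all_classical all_reals all_analysis.
Set Implicit Arguments.
Unset Strict Implicit.
Unset Printing Implicit Defensive.
Import Order.TTheory GRing.Theory Num.Theory.
Import numFieldNormedType.Exports.
Local Open Scope classical_set_scope.
Local Open Scope ring_scope.

Definition minimizer_on (R : realType) (T : Type) (A : set T) (g : T -> R)
    (x : T) : Prop :=
  A x /\ forall y, A y -> g x <= g y.

(* The Euclidean space E is 'rV[R]_n with its coordinatewise inner product. *)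
Section Euclidean.
Variables (R : realType) (n : nat).
Local Notation E := 'rV[R]_n.

Definition dot (x y : E) : R := \sum_(i < n) x 0 i * y 0 i.

Definition self_adjoint (B : E -> E) : Prop :=
  forall x y, dot (B x) y = dot x (B y).

Definition positive_definite (B : E -> E) : Prop :=
  forall x, x != 0 -> 0 < dot (B x) x.

(* Not to be confused with `|x|, which is the sup norm on 'rV[R]_n. *)
Definition enorm (B : E -> E) (x : E) : R := Num.sqrt (dot (B x) x).

Definition grad (f : E -> R) (x : E) : E :=
  \row_(i < n) ('d f x) (delta_mx 0 i).

Definition closed_convex_cone (K : set E) : Prop :=
  [/\ closed K, convex_set K &
      forall (a : R) x, 0 < a -> K x -> K (a *: x)].

Definition multilinear (k : nat) (Q : ('I_k -> E) -> R) : Prop :=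
  forall (v : 'I_k -> E) (i : 'I_k),
    scalar (fun x : E => Q (@dfwith 'I_k (fun=> E) v i x)).

Definition perm_invariant (k : nat) (Q : ('I_k -> E) -> R) : Prop :=
  forall (s : 'S_k) (v : 'I_k -> E), Q (v \o s) = Q v.

Definition convex_quartic_form (rho : E -> R) : Prop :=
  convex_function setT rho /\
  exists Q : ('I_4 -> E) -> R,
    [/\ multilinear Q, perm_invariant Q & forall x, rho x = Q (fun=> x)].

Definition hom_feasible (K : set E) (c : E) : set E :=
  [set y | K y /\ dot c y = 1].

End Euclidean.

Section Method.
Variables (R : realType) (n : nat).
Local Notation E := 'rV[R]_n.
Variables (B : E -> E) (K : set E) (c : E) (rho : E -> R) (beta : R).

Definition pg_step (z : E) : E -> Prop :=
  minimizer_on (hom_feasible K c)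
    (fun y => (2 * Num.sqrt (rho z))^-1 * dot (grad rho z) (y - z)
              + 3 * beta * enorm B (y - z) ^+ 2).

Definition inner_loop (N : nat) (y v : E) : Prop :=
  exists u z : nat -> E,
    [/\ u 0%N = y, z 0%N = y,
        forall k : nat, (k < N)%N ->
          pg_step (z k) (u k.+1) /\
          z k.+1 = u k.+1 + (k%:R / (k + 3)%N%:R) *: (u k.+1 - u k)
      & v = u N].

(* A relation rather than a function, because of possible ties in the choice
   of y (t + 1).  That choice compares values of rho only, so y0 has to be
   feasible for the iterates to be: an infeasible y0 with a small enough
   value of rho is never replaced. *)
Definition ahgm_run (T : nat) (y0 : E) (y : nat -> E) : Prop :=
  y 0%N = y0 /\
  forall t : nat, (t < T)%N ->
    exists2 v : E, inner_loop (2 ^ t)%N (y t) v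
                 & minimizer_on [set y t; v] rho (y t.+1).

Definition ahgm_returns (T : nat) (y0 x : E) : Prop :=
  exists2 y : nat -> E, ahgm_run T y0 y
    & x = ((4 * rho (y T)) `^ (1 / 3))^-1 *: y T.

End Method.

Definition pg_steps (T : nat) : nat := (\sum_(t < T) 2 ^ t)%N.

(* Main.v *)
(* Write rho x = Q(x,x,x,x) and g = sqrt rho.  Convexity of rho says that
   Q(u,u,v,v) >= 0, and restricted to a plane this yields enough Cauchy-Schwarz
   inequalities to show that g is convex, that
     g y <= g z + g'(z)(y - z) + 3 g (y - z),
   so that g is smooth with constant 6 beta, and that rho is uniformly convex,
     rho (z + h) >= rho z + rho'(z) h + rho h / 3.
   By the last inequality the distance from a feasible y to ystar is controlled
   by the gap: alpha ||y - ystar||^2 <= sqrt (3 (rho y - rho ystar)).  Hence an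
   accelerated inner loop of N = 2^t steps maps the relative gap e of g to at
   most 12 sqrt 3 kappa sqrt (e (2 + e)) / N^2, and by induction e_t decreases
   like kappa^2 (1 + delta0) / 16^t.  Finally, the relative gap of f at the
   rescaled point is 1 - (1 + e)^(-2/3) <= e. *)
Require Import Defs.
From HB Require Import structures.
From mathcomp Require Import all_boot all_order all_algebra all_fingroup.
From mathcomp Require Import all_classical all_reals all_analysis.
From mathcomp Require Import ring lra.
Set Implicit Arguments.
Unset Strict Implicit.
Unset Printing Implicit Defensive.
Import Order.TTheory GRing.Theory Num.Theory.
Import numFieldNormedType.Exports.
Local Open Scope classical_set_scope.
Local Open Scope ring_scope.

(** * Inequalities between the coefficients of a convex binary quartic *)

Section BinaryQuartic.
Variable R : rcfType.
Implicit Types a b c d x y s t p r G H : R.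

Lemma ler_of_sqr x y : 0 <= y -> x ^+ 2 <= y ^+ 2 -> x <= y.
Proof.
move=> y0 xy; apply: le_trans (ler_norm x) _.
by rewrite -ler_sqr ?nnegrE // real_normK // num_real.
Qed.

Lemma quadratic_form_cs a b c :
  (forall p r, 0 <= a * p ^+ 2 + 2 * b * p * r + c * r ^+ 2) -> b ^+ 2 <= a * c.
Proof.
move=> h.
have a0 : 0 <= a by have := h 1 0; lra.
have c0 : 0 <= c by have := h 0 1; lra.
have [a_gt0|] := ltP 0 a.
  have := h (- b) a.
  have -> : a * (- b) ^+ 2 + 2 * b * (- b) * a + c * a ^+ 2 = a * (a * c - b ^+ 2)
    by ring.
  by rewrite pmulr_rge0 // subr_ge0.
move=> a_le0; have a_eq0 : a = 0 by apply/eqP; rewrite eq_le a_le0 a0.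
(* For a = 0 this test point gives - (c + 2) b^2 >= 0, which forces b = 0. *)
have := h (- c - 1) b; have := mulr_ge0 c0 (sqr_ge0 b); have := sqr_ge0 b.
rewrite a_eq0; nra.
Qed.

(* [Q(u,u,v,v)] for [u = s z + t h] and [v = p z + r h], where the [a_i] are
   [Q(z,z,z,z)], [Q(z,z,z,h)], ..., [Q(h,h,h,h)]. *)
Definition quartic_hessian (a0 a1 a2 a3 a4 s t p r : R) : R :=
  a0 * (s ^+ 2 * p ^+ 2) + a1 * (2 * s * t * p ^+ 2 + 2 * s ^+ 2 * p * r)
  + a2 * (t ^+ 2 * p ^+ 2 + 4 * s * t * p * r + s ^+ 2 * r ^+ 2)
  + a3 * (2 * t ^+ 2 * p * r + 2 * s * t * r ^+ 2) + a4 * (t ^+ 2 * r ^+ 2).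

(** [quartic_hessian] is 1/12 of the second derivative at u in direction v, so this is convexity of
    rho on the plane of z and h. *)
Definition convex_coefs (a0 a1 a2 a3 a4 : R) : Prop :=
  forall s t p r, 0 <= quartic_hessian a0 a1 a2 a3 a4 s t p r.

Section Coefs.
Variables (a0 a1 a2 a3 a4 : R) (cvx : convex_coefs a0 a1 a2 a3 a4).

Lemma convex_coefs_ge0 : [/\ 0 <= a0, 0 <= a2 & 0 <= a4].
Proof.
split.
- by have := cvx 1 0 1 0; rewrite /quartic_hessian; lra.
- by have := cvx 0 1 1 0; rewrite /quartic_hessian; lra.
- by have := cvx 0 1 0 1; rewrite /quartic_hessian; lra.
Qed.

Lemma convex_coefs_cs1 : a1 ^+ 2 <= a0 * a2.
Proof.
apply: quadratic_form_cs => p r; have := cvx 1 0 p r.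
by rewrite /quartic_hessian; congr (0 <= _); ring.
Qed.

Lemma convex_coefs_cs3 : a3 ^+ 2 <= a2 * a4.
Proof.
apply: quadratic_form_cs => p r; have := cvx 0 1 p r.
by rewrite /quartic_hessian; congr (0 <= _); ring.
Qed.

(** For p, r >= 0 the vectors u, v = sqrt p z +- sqrt r h cancel the odd terms and leave a0 p^2 - 2
    a2 p r + a4 r^2 >= 0. For opposite signs of p and r the middle term is nonnegative, because a2
    is. *)
Lemma convex_coefs_cs2 : a2 ^+ 2 <= a0 * a4.
Proof.
have [h0 h2 h4] := convex_coefs_ge0.
rewrite -sqrrN; apply: quadratic_form_cs.
have pos p r : 0 <= p -> 0 <= r ->
    0 <= a0 * p ^+ 2 + 2 * - a2 * p * r + a4 * r ^+ 2.
  move=> /sqr_sqrtr <- /sqr_sqrtr <-.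
  have := cvx (Num.sqrt p) (Num.sqrt r) (Num.sqrt p) (- Num.sqrt r).
  by rewrite /quartic_hessian; congr (0 <= _); ring.
move=> p r; have [p0|p0] := leP 0 p; have [r0|r0] := leP 0 r; first exact: pos.
- have := mulr_ge0 h2 (mulr_ge0 p0 (_ : 0 <= - r)).
  have := mulr_ge0 h0 (sqr_ge0 p); have := mulr_ge0 h4 (sqr_ge0 r); nra.
- have := mulr_ge0 h2 (mulr_ge0 (_ : 0 <= - p) r0).
  have := mulr_ge0 h0 (sqr_ge0 p); have := mulr_ge0 h4 (sqr_ge0 r); nra.
- have := pos (- p) (- r); rewrite !oppr_ge0 => /(_ (ltW p0) (ltW r0)).
  by congr (0 <= _); ring.
Qed.

(** AM-GM on a3^2 <= a2 a4 gives |a3| <= 3/2 a2 + a4 / 6. The weights are such that 4 a3 can at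
    worst cancel 6 a2 exactly and two thirds of a4. *)
Lemma quartic_uniformly_convex : a4 / 3 <= 6 * a2 + 4 * a3 + a4.
Proof.
have [_ h2 h4] := convex_coefs_ge0.
have h : (- a3) ^+ 2 <= ((3 / 2 * a2 + a4 / 6)) ^+ 2.
  have := convex_coefs_cs3; have := sqr_ge0 (3 / 2 * a2 - a4 / 6); lra.
have := ler_of_sqr _ h; lra.
Qed.

(** Here h is the point y itself, not the increment y - z. The left side is the tangent of g at z
    evaluated at y, because g'(z) z = 2 g z. The bound follows from a1^2 <= a0 a2 <= G^2 (G H) and
    AM-GM. *)
Lemma sqrt_quartic_tangent G H : 0 < G -> 0 <= H -> a0 = G ^+ 2 -> a4 = H ^+ 2 ->
  2 * a1 / G - G <= H.
Proof.
move=> G0 H0 e0 e4; have [_ h2 _] := convex_coefs_ge0.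
have ha2 : a2 <= G * H.
  by apply: ler_of_sqr; [nra|rewrite exprMn -e0 -e4; exact: convex_coefs_cs2].
have h : a1 <= G * ((G + H) / 2).
  apply: ler_of_sqr; first nra.
  apply: le_trans convex_coefs_cs1 _; rewrite e0 exprMn ler_wpM2l ?sqr_ge0 //.
  have := sqr_ge0 (G - H); nra.
rewrite lerBlDr ler_pdivrMr //; nra.
Qed.

End Coefs.

(* With p = z + h and m = z - h one has Q(p,p,p,m) = 2 (a - c) and
   Q(p,p,m,m) = 2 (1 - b).  Cauchy-Schwarz for Q(p,p,.,.) and Q(m,m,.,.) and
   rho p + rho m = 4 + 12 b <= 16 give (a - c)^2 <= 4 (1 - b). *)
Lemma sqrt_quartic_smooth_normalized a b c : convex_coefs 1 a b c 1 ->
  (3 * a - c) ^+ 2 <= 12 * (1 - b) + 8 * a ^+ 2.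
Proof.
move=> cvx; have [_ b0 _] := convex_coefs_ge0 cvx.
have b1 : b <= 1.
  by apply: ler_of_sqr => //; have := convex_coefs_cs2 cvx; lra.
have pm : (2 * (a - c)) ^+ 2 <= (2 + 4 * a + 6 * b + 4 * c) * (2 * (1 - b)).
  apply: quadratic_form_cs => p r; have := cvx 1 1 (p + r) (p - r).
  by rewrite /quartic_hessian; congr (0 <= _); ring.
have mp : (2 * (a - c)) ^+ 2 <= (2 - 4 * a + 6 * b - 4 * c) * (2 * (1 - b)).
  apply: quadratic_form_cs => p r; have := cvx 1 (- 1) (p - r) (- p - r).
  by rewrite /quartic_hessian; congr (0 <= _); ring.
(* 3 a - c = 2 a + (a - c), and the square of a sum is at most twice the sum of the squares. *)
have := sqr_ge0 (2 * a - (a - c)); nra.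
Qed.

(** If H = 0, Cauchy-Schwarz makes a1, a2, a3 vanish and both sides equal G. Otherwise dividing z
    and h by sqrt G and sqrt H reduces to outer coefficients 1. *)
Lemma sqrt_quartic_smooth a0 a1 a2 a3 a4 G H : convex_coefs a0 a1 a2 a3 a4 ->
  0 < G -> 0 <= H -> a0 = G ^+ 2 -> a4 = H ^+ 2 ->
  Num.sqrt (a0 + 4 * a1 + 6 * a2 + 4 * a3 + a4) <= G + 2 * a1 / G + 3 * H.
Proof.
move=> cvx G0 H0 e0 e4.
have [/eqP|Hn] := eqVneq H 0.
  move=> /eqP HE; rewrite HE in e4.
  have := convex_coefs_cs2 cvx; rewrite e4 expr0n /= mulr0 => h2.
  have a20 : a2 = 0 by apply/eqP; rewrite -sqrf_eq0 eq_le h2 sqr_ge0.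
  have := convex_coefs_cs1 cvx; rewrite a20 mulr0 => h1.
  have a10 : a1 = 0 by apply/eqP; rewrite -sqrf_eq0 eq_le h1 sqr_ge0.
  have := convex_coefs_cs3 cvx; rewrite a20 mul0r => h3.
  have a30 : a3 = 0 by apply/eqP; rewrite -sqrf_eq0 eq_le h3 sqr_ge0.
  by rewrite a10 a30 HE !mulr0 mul0r !addr0 e0 sqrtr_sqr gtr0_norm.
have {Hn H0} H0 : 0 < H by rewrite lt_neqAle eq_sym Hn.
pose g := Num.sqrt G; pose h := Num.sqrt H.
have g0 : 0 < g by rewrite sqrtr_gt0.
have h0 : 0 < h by rewrite sqrtr_gt0.
have GE : G = g ^+ 2 by rewrite sqr_sqrtr // ltW.
have HE : H = h ^+ 2 by rewrite sqr_sqrtr // ltW.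
have gn : g != 0 by rewrite gt_eqF.
have hn : h != 0 by rewrite gt_eqF.
pose a := a1 / (g ^+ 3 * h); pose b := a2 / (g ^+ 2 * h ^+ 2).
pose c := a3 / (g * h ^+ 3).
have a1E : a1 = a * (g ^+ 3 * h) by rewrite /a; field; rewrite gn hn.
have a2E : a2 = b * (g ^+ 2 * h ^+ 2) by rewrite /b; field; rewrite gn hn.
have a3E : a3 = c * (g * h ^+ 3) by rewrite /c; field; rewrite gn hn.
have cvx1 : convex_coefs 1 a b c 1.
  move=> s t p r; have := cvx (s / g) (t / h) (p / g) (r / h).
  rewrite /quartic_hessian a1E a2E a3E e0 e4 GE HE.
  by congr (0 <= _); field; rewrite gn hn.
have key := sqrt_quartic_smooth_normalized cvx1.
have [_ b0 _] := convex_coefs_ge0 cvx1.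
have b1 : b <= 1.
  by apply: ler_of_sqr => //; have := convex_coefs_cs2 cvx1; lra.
have rE : G + 2 * a1 / G + 3 * H = g ^+ 2 + 2 * a * g * h + 3 * h ^+ 2.
  by rewrite a1E GE HE; field.
have a_bound : - a <= 1.
  apply: ler_of_sqr => //; have := convex_coefs_cs1 cvx1; lra.
have r0 : 0 <= g ^+ 2 + 2 * a * g * h + 3 * h ^+ 2.
  have := mulr_ge0 (ltW g0) (ltW h0); have := sqr_ge0 (g - h); nra.
rewrite rE -[leRHS]ger0_norm // -sqrtr_sqr ler_wsqrtr //.
rewrite a1E a2E a3E e0 e4 GE HE -subr_ge0.
(* Completing the square in h leaves a remainder that is nonnegative by the normalized inequality
   [key]. *)
have -> : (g ^+ 2 + 2 * a * g * h + 3 * h ^+ 2) ^+ 2 - ((g ^+ 2) ^+ 2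
    + 4 * (a * (g ^+ 3 * h)) + 6 * (b * (g ^+ 2 * h ^+ 2))
    + 4 * (c * (g * h ^+ 3)) + (h ^+ 2) ^+ 2)
  = h ^+ 2 * (8 * (h + g * (3 * a - c) / 4) ^+ 2
      + g ^+ 2 * ((12 * (1 - b) + 8 * a ^+ 2 - (3 * a - c) ^+ 2) / 2)) by field.
apply: mulr_ge0; first exact: sqr_ge0.
apply: addr_ge0; first by rewrite mulr_ge0 ?sqr_ge0.
by apply: mulr_ge0; [exact: sqr_ge0|lra].
Qed.

End BinaryQuartic.

(** * Restriction of a convex quartic form to planes *)

Section QuarticForm.
Variables (R : realType) (n : nat).
Local Notation E := 'rV[R]_n.
Implicit Types x y z h : E.

Definition quad (a b c d : E) : 'I_4 -> E := tnth [tuple a; b; c; d].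

(** Linearity is proved in the last slot only; these adjacent swaps carry it to the other three. *)
Lemma quad_perm (Q : ('I_4 -> E) -> R) : perm_invariant Q ->
  [/\ forall a b c d, Q (quad a b c d) = Q (quad b a c d),
      forall a b c d, Q (quad a b c d) = Q (quad a c b d)
    & forall a b c d, Q (quad a b c d) = Q (quad a b d c)].
Proof.
move=> Qs; have swap (k l : nat) a b c d : (k < 4)%N -> (l < 4)%N ->
    Q (quad a b c d) = Q (fun i : 'I_4 => nth 0 [:: a; b; c; d]
      (if i == k :> nat then l else if i == l :> nat then k else i)).
  move=> k4 l4; rewrite -(Qs (tperm (inord k) (inord l))); congr Q.
  apply/funext => i /=; rewrite /quad (tnth_nth 0) /=; congr nth.
  case: tpermP => [->|->|/eqP + /eqP]; rewrite -?val_eqE /= ?inordK // ?eqxx //.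
    by case: eqP.
  by move=> /negPf -> /negPf ->.
split=> a b c d.
- rewrite (swap 0 1)%N //; congr Q; apply/funext => i; rewrite /quad (tnth_nth 0).
  by case: i => [[|[|[|[|i]]]] hi].
- rewrite (swap 1 2)%N //; congr Q; apply/funext => i; rewrite /quad (tnth_nth 0).
  by case: i => [[|[|[|[|i]]]] hi].
- rewrite (swap 2 3)%N //; congr Q; apply/funext => i; rewrite /quad (tnth_nth 0).
  by case: i => [[|[|[|[|i]]]] hi].
Qed.

Lemma quad_linear (Q : ('I_4 -> E) -> R) a b c :
  multilinear Q -> scalar (fun x => Q (quad a b c x)).
Proof.
move=> /(_ (quad a b c 0) (inord 3)) Ql k x y.
have e z : quad a b c z = dfwith (quad a b c 0) (inord 3) z.
  apply/funext => i; have [<-|ni] := eqVneq (inord 3) i.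
    by rewrite dfwithin /quad (tnth_nth 0) inordK.
  rewrite dfwithout // /quad !(tnth_nth 0) /=.
  by move: ni; case: i => [[|[|[|[|i]]]] hi] //=; rewrite -val_eqE /= inordK.
by rewrite (e (k *: x + y)) (e x) (e y) Ql.
Qed.

(* [q1 z h = Q(z,z,z,h)] and [q2 z h = Q(z,z,h,h)]. *)
Definition quartic_polars (rho : E -> R) (q1 q2 : E -> E -> R) : Prop :=
  forall z h s t, rho (s *: z + t *: h) = s ^+ 4 * rho z
    + 4 * s ^+ 3 * t * q1 z h + 6 * s ^+ 2 * t ^+ 2 * q2 z h
    + 4 * s * t ^+ 3 * q1 h z + t ^+ 4 * rho h.

Lemma quartic_form_binary (rho : E -> R) : convex_quartic_form rho ->
  exists q1 q2 : E -> E -> R,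
    (forall z, scalar (q1 z)) /\
    quartic_polars rho q1 q2.
Proof.
move=> [_ [Q [Ql Qs Qrho]]].
pose q a b c d := Q (quad a b c d).
have [s1 s2 s3] : [/\ forall a b c d, q a b c d = q b a c d,
      forall a b c d, q a b c d = q a c b d
    & forall a b c d, q a b c d = q a b d c] by exact: quad_perm.
have l4 a b c k l x y : q a b c (k *: x + l *: y) = k * q a b c x + l * q a b c y.
  have L := quad_linear a b c Ql.
  have q0 : q a b c 0 = 0.
    by have := L 1 0 0; rewrite scaler0 addr0 /= mul1r /q; lra.
  rewrite /q L; congr (_ + _).
  by have := L l y 0; rewrite !addr0 => ->; rewrite -/(q a b c 0) q0 addr0.
have rq x : rho x = q x x x x.
  rewrite Qrho; congr Q; apply/funext => i; rewrite /quad (tnth_nth 0).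
  by case: i => [[|[|[|[|i]]]] hi].
exists (fun z h => q z z z h), (fun z h => q z z h h); split.
  by move=> z; exact: quad_linear.
move=> z h s t.
have l3 a b d k l x y : q a b (k *: x + l *: y) d = k * q a b x d + l * q a b y d.
  by rewrite s3 l4 (s3 a b d x) (s3 a b d y).
have l2 a c d k l x y : q a (k *: x + l *: y) c d = k * q a x c d + l * q a y c d.
  by rewrite s2 l3 (s2 a c x) (s2 a c y).
have l1 b c d k l x y : q (k *: x + l *: y) b c d = k * q x b c d + l * q y b c d.
  by rewrite s1 l2 (s1 b x) (s1 b y).
rewrite !rq l1 !l2 !l3 !l4.
rewrite (s1 h z z z) (s2 z h z z) (s3 z z h z).
rewrite (s2 h h z z) (s3 h z h z) (s3 z h h z) (s1 h z z h) (s2 z h z h).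
rewrite (s1 z h h h) (s2 h z h h) (s3 h h z h).
ring.
Qed.

Lemma convex_functionP (rho : E -> R) x y t : convex_function setT rho ->
  0 <= t -> t <= 1 -> rho (t *: x + (1 - t) *: y) <= t * rho x + (1 - t) * rho y.
Proof.
move=> rc t0 t1.
by have := rc (Itv01 t0 t1) x y (in_setT _) (in_setT _); rewrite convRE.
Qed.

Lemma convex_setP (K : set E) x y t : convex_set K -> K x -> K y ->
  0 <= t -> t <= 1 -> K (t *: x + (1 - t) *: y).
Proof.
move=> Kc Kx Ky t0 t1.
by have := Kc x y (Itv01 t0 t1) (mem_set Kx) (mem_set Ky); rewrite inE.
Qed.

(** Midpoint convexity at u + d v and u - d v gives 0 <= 6 d^2 Q(u,u,v,v) + d^4 rho v. Dividing by e
    = d^2 and letting e tend to 0 leaves the Hessian term. *)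
Lemma quartic_form_convex_coefs (rho : E -> R) (q1 q2 : E -> E -> R) :
  convex_function setT rho ->
  quartic_polars rho q1 q2 ->
  forall z h, convex_coefs (rho z) (q1 z h) (q2 z h) (q1 h z) (rho h).
Proof.
move=> rc rE z h s t p r.
set H := quartic_hessian _ _ _ _ _ _ _ _ _.
pose r4 := rho (p *: z + r *: h).
have key e : 0 < e -> 0 <= 6 * H + e * r4.
  move=> e0; have en : e != 0 by rewrite gt_eqF.
  pose d := Num.sqrt e.
  have dE : e = d ^+ 2 by rewrite sqr_sqrtr // ltW.
  have := @convex_functionP rho ((s + d * p) *: z + (t + d * r) *: h)
    ((s - d * p) *: z + (t - d * r) *: h) (1 / 2) rc.
  have -> : (1 / 2) *: ((s + d * p) *: z + (t + d * r) *: h)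
    + (1 - 1 / 2) *: ((s - d * p) *: z + (t - d * r) *: h) = s *: z + t *: h.
    rewrite !scalerDr !scalerA addrACA -!scalerDl.
    by congr (_ *: _ + _ *: _); field.
  have e2 : 0 < e * 2 by rewrite mulr_gt0.
  move=> /(_ ltac:(lra) ltac:(lra)); rewrite -subr_ge0 => cv.
  rewrite -(pmulr_rge0 _ e0); apply: le_trans cv _; rewrite le_eqVlt; apply/orP; left.
  by apply/eqP; rewrite dE /r4 /H /quartic_hessian !rE; field.
rewrite leNgt; apply/negP => H0.
have [r0|r0] := leP r4 0; first by have := key 1 ltr01; lra.
(* This e replaces the limit: it yields 0 <= 5 H, against H < 0. *)
have := key (- H / r4); rewrite divr_gt0 ?oppr_gt0 // => /(_ isT).
by rewrite divfK ?gt_eqF //; lra.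
Qed.

End QuarticForm.

(** * Inner product, norm comparison, minimizers of quadratic models, and the gradient of a
    quartic *)

Section EuclideanTheory.
Variables (R : realType) (n : nat).
Local Notation E := 'rV[R]_n.
Implicit Types x y z h : E.

Lemma dotC x y : dot x y = dot y x.
Proof. by apply: eq_bigr => i _; rewrite mulrC. Qed.

Lemma dot_linear x : scalar (dot x).
Proof.
move=> k y z; rewrite /dot mulr_sumr -big_split /=; apply: eq_bigr => i _.
by rewrite !mxE; ring.
Qed.

Lemma dotDr x y z : dot x (y + z) = dot x y + dot x z.
Proof. by have := dot_linear x 1 y z; rewrite scale1r mul1r. Qed.

Lemma dot0r x : dot x 0 = 0.
Proof. by rewrite /dot big1 // => i _; rewrite mxE mulr0. Qed.

Lemma dotZr x k y : dot x (k *: y) = k * dot x y.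
Proof. by have := dot_linear x k y 0; rewrite addr0 dot0r addr0. Qed.

Lemma dotBr x y z : dot x (y - z) = dot x y - dot x z.
Proof. by rewrite dotDr -scaleN1r dotZr mulN1r. Qed.

Lemma scalar_dot (l : E -> R) : scalar l ->
  forall h, l h = dot (\row_i l (delta_mx 0 i)) h.
Proof.
move=> ll h; pose HL := GRing.isLinear.Build R E R *%R l ll.
pose L : {linear E -> R | *%R} := HB.pack l HL.
have -> : l h = L h by [].
rewrite {1}[h]row_sum_delta linear_sum; apply: eq_bigr => i _.
by rewrite linearZ /= mxE mulrC.
Qed.

Lemma coord_le_norm x i : `|x 0 i| <= `|x|.
Proof.
rewrite [`|x|]mx_normrE.
by apply: (@le_bigmax _ _ _ 0 (fun ij => `|x ij.1 ij.2|) (0, i)).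
Qed.

Lemma dot_bounded x : exists2 k : R, 0 <= k & forall h, `|dot x h| <= k * `|h|.
Proof.
exists (\sum_(i < n) `|x 0 i|); first exact: sumr_ge0.
move=> h; rewrite mulr_suml; apply: le_trans (ler_norm_sum _ _ _) _.
by apply: ler_sum => i _; rewrite normrM ler_wpM2l // coord_le_norm.
Qed.

Lemma dot_continuous x : continuous (dot x).
Proof.
have -> : dot x = (fun h => \sum_(i < n) x 0 i * h 0 i) by [].
apply: (@continuous_big _ _ _ _ _ add_continuous _ _ (fun i h => x 0 i * h 0 i)).
move=> i _ y.
apply: (@cvgM _ _ _ (nbhs_filter y) (cst (x 0 i)) (fun h : E => h 0 i)).
  exact: (@cvg_cst _ _ _ _ (nbhs_filter y)).
exact: coord_continuous.
Qed.

Section Norm.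
Variable B : {linear E -> E}.
Hypotheses (Bs : self_adjoint B) (Bpos : positive_definite B).

Lemma enorm_sqr x : enorm B x ^+ 2 = dot (B x) x.
Proof.
rewrite sqr_sqrtr //; have [->|/Bpos/ltW//] := eqVneq x 0.
by rewrite dot0r.
Qed.

Lemma enorm_sqr_line x y t : enorm B (x + t *: y) ^+ 2
  = enorm B x ^+ 2 + 2 * t * dot (B x) y + t ^+ 2 * enorm B y ^+ 2.
Proof.
rewrite !enorm_sqr linearD linearZ /= !dotDr !dotZr.
rewrite ![dot (_ + _) _]dotC !dotDr !dotZr [dot y (B x)]dotC [dot x (B y)]dotC Bs.
by rewrite [dot x (B x)]dotC [dot y (B y)]dotC [dot y (B x)]dotC; ring.
Qed.

Lemma enorm_sqrZ t x : enorm B (t *: x) ^+ 2 = t ^+ 2 * enorm B x ^+ 2.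
Proof.
by rewrite !enorm_sqr linearZ /= dotZr dotC dotZr dotC; ring.
Qed.

Lemma enorm_sqr_continuous : continuous (fun x => enorm B x ^+ 2).
Proof.
have -> : (fun x => enorm B x ^+ 2) =
    (fun x => \sum_(i < n) dot (\row_j (lin1_mx B) j i) x * x 0 i).
  apply/funext => x; rewrite enorm_sqr; apply: eq_bigr => i _; congr (_ * _).
  rewrite -mul_rV_lin1 mxE; apply: eq_bigr => j _.
  by rewrite mulrC; congr (_ * _); rewrite [RHS]mxE.
apply: (@continuous_big _ _ _ _ _ add_continuous _ _
  (fun i h => dot (\row_j (lin1_mx B) j i) h * h 0 i)) => i _ y.
apply: (@cvgM _ _ _ (nbhs_filter y) (dot _) (fun h : E => h 0 i)).
  exact: dot_continuous.
exact: coord_continuous.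
Qed.

(** The topology is that of the sup norm. Its unit sphere is compact, so the continuous
    [enorm B x ^+ 2] has positive extreme values there, and homogeneity does the rest. *)
Lemma enorm_sqr_bounds : exists m M : R, [/\ 0 < m, 0 <= M &
  forall x, m * `|x| ^+ 2 <= enorm B x ^+ 2 /\ enorm B x ^+ 2 <= M * `|x| ^+ 2].
Proof.
have cS : compact [set x : E | `|x| = 1].
  apply: bounded_closed_compact.
    by exists 1; split => // r r1 x /= ->; exact: ltW.
  have -> : [set x : E | `|x| = 1] = Num.norm @^-1` [set 1] by [].
  apply: closed_comp; last exact: closed_eq.
  by move=> x _; exact: norm_continuous.
have cN : {within [set x : E | `|x| = 1], continuous (fun x => enorm B x ^+ 2)}.
  by apply: continuous_subspaceT; exact: enorm_sqr_continuous.
(* The sphere is empty only for the zero space, where any constants do. *)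
have [[x0 x01]|S0] := pselect ([set x : E | `|x| = 1] !=set0); last first.
  exists 1, 0; split => // x.
  suff -> : x = 0 by rewrite normr0 !enorm_sqr dot0r expr0n /= !mulr0.
  apply/eqP/negP => /negP xn; apply: S0; exists (`|x|^-1 *: x) => /=.
  by rewrite normrZ normfV normr_id mulVf // normr_eq0.
have S0 : [set x : E | `|x| = 1] !=set0 by exists x0.
have [a /set_mem a1 am] := EVT_min_rV S0 cS cN.
have [b /set_mem b1 bm] := EVT_max_rV S0 cS cN.
exists (enorm B a ^+ 2), (enorm B b ^+ 2); split; last 1 first.
- move=> x; have [->|xn] := eqVneq x 0.
    by rewrite normr0 [enorm B 0 ^+ 2]enorm_sqr dot0r expr0n /= !mulr0.
  have xS : `|x|^-1 *: x \in [set x : E | `|x| = 1].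
    by rewrite inE /= normrZ normfV normr_id mulVf // normr_eq0.
  have := am _ xS; have := bm _ xS; rewrite enorm_sqrZ exprVn mulrC.
  have x2 : 0 < `|x| ^+ 2 by rewrite exprn_gt0 // normr_gt0.
  by rewrite ler_pdivrMr // ler_pdivlMr.
- rewrite enorm_sqr; apply: Bpos; apply/eqP => a0.
  by move: a1; rewrite /= a0 normr0 => /esym/eqP; rewrite oner_eq0.
- exact: sqr_ge0.
Qed.

(** The quadratic term makes the model coercive, so its sublevel set through a point of A is
    compact. *)
Lemma quadratic_model_minimizer (A : set E) (l z : E) (k : R) :
  closed A -> A !=set0 -> 0 < k ->
  exists u, minimizer_on A (fun y => dot l (y - z) + k * enorm B (y - z) ^+ 2) u.
Proof.
move=> Ac [a Aa] k0.
pose phi := fun y : E => dot l (y - z) + k * enorm B (y - z) ^+ 2.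
have [m [M0 [m0 _ mM]]] := enorm_sqr_bounds.
have [L L0 Ll] := dot_bounded l.
have phic : continuous phi.
  move=> y; have sub : {for y, continuous (fun y : E => y - z)}.
    by apply: (@cvgB _ _ _ _ (nbhs_filter y)); [exact: cvg_id|exact: cvg_cst].
  apply: (@cvgD _ _ _ _ (nbhs_filter y) (fun y => dot l (y - z))).
    by apply: continuous_comp; [exact: sub|exact: dot_continuous].
  apply: (@cvgM _ _ _ (nbhs_filter y) (cst k) (fun y => enorm B (y - z) ^+ 2)).
    exact: (@cvg_cst _ _ _ _ (nbhs_filter y)).
  apply: (@continuous_comp _ _ _ (fun y => y - z) (fun x => enorm B x ^+ 2)).
    exact: sub.
  exact: enorm_sqr_continuous.
pose S := A `&` (phi @^-1` [set t | t <= phi a]).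
have Sc : compact S.
  apply: bounded_closed_compact; last first.
    apply: closedI => //; apply: closed_comp; last exact: closed_le.
    by move=> x _; exact: phic.
  (* Beyond radius M the quadratic term k m r^2 exceeds L r + |phi a|. The summand 1 ensures r >= 1,
     hence |phi a| <= |phi a| r. *)
  pose M := (L + `|phi a|) / (k * m) + 1.
  have km : 0 < k * m by rewrite mulr_gt0.
  have M1 : 1 <= M.
    by rewrite lerDr; apply: divr_ge0; [exact: addr_ge0|exact: ltW].
  have Sb y : S y -> `|y - z| <= M.
    move=> [_ /= Sy]; rewrite leNgt; apply/negP => My.
    have y1 : 1 <= `|y - z| by apply: le_trans M1 (ltW My).
    have h : L + `|phi a| < k * m * `|y - z|.
      by move: My; rewrite -ltrBrDr ltr_pdivrMr // mulrC; nra.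
    have [h1 _] := mM (y - z); have h2 := Ll (y - z).
    have h3 : - dot l (y - z) <= L * `|y - z|.
      by apply: le_trans h2; rewrite -normrN ler_norm.
    have h4 := ler_norm (phi a).
    have h5 : k * (m * `|y - z| ^+ 2) <= k * enorm B (y - z) ^+ 2.
      by rewrite ler_pM2l.
    have h6 : (L + `|phi a|) * `|y - z| < k * m * `|y - z| * `|y - z|.
      by rewrite ltr_pM2r //; lra.
    have h7 : `|phi a| <= `|phi a| * `|y - z| by rewrite ler_peMr.
    by move: Sy; rewrite {1}/phi; nra.
  exists (M + `|z|); split; first exact: num_real.
  move=> r rM y /Sb yM; rewrite -[y](subrK z).
  by apply: le_trans (ler_normD _ _) _; lra.
have Sn : S !=set0 by exists a; split => //=.
have [u /set_mem [Au ua] um] := EVT_min_rV Sn Sc (continuous_subspaceT phic).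
exists u; split=> // y Ay; have [ya|/ltW ya] := leP (phi y) (phi a).
  by apply: um; rewrite inE.
exact: le_trans ua ya.
Qed.

End Norm.

(** In the expansion of rho (z + x) all terms beyond 4 [q1 z x] are O(|x|^2). Cauchy-Schwarz bounds
    [q2 z x] and [q1 x z] through the growth bound on rho. *)
Lemma dot_grad (rho : E -> R) (q1 q2 : E -> E -> R) (k : R) :
  (forall z, scalar (q1 z)) ->
  quartic_polars rho q1 q2 ->
  (forall z h, convex_coefs (rho z) (q1 z h) (q2 z h) (q1 h z) (rho h)) ->
  (forall h, rho h <= (k * `|h| ^+ 2) ^+ 2) ->
  forall z h, dot (grad rho z) h = 4 * q1 z h.
Proof.
move=> q1l rE cvx rk z h.
have dl : scalar (fun h => 4 * q1 z h) by move=> t x y; rewrite q1l; ring.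
pose HL := GRing.isLinear.Build R E R *%R _ dl.
pose L : {linear E -> R} := HB.pack (fun h => 4 * q1 z h) HL.
have Lc : continuous L.
  have -> : (L : E -> R) = dot (\row_i L (delta_mx 0 i)).
    by apply/funext => x; exact: scalar_dot.
  exact: dot_continuous.
have dE : 'd rho z = L :> (E -> R).
  apply: diff_unique => //; apply/eqaddoP => _/posnumP[e].
  (* AM-GM: the remainder is at most 8 q2 + 3 rho. *)
  pose C := 8 * (Num.sqrt (rho z) * `|k|) + 3 * k ^+ 2.
  have C0 : 0 <= C.
    by have := sqrtr_ge0 (rho z); have := normr_ge0 k; have := sqr_ge0 k; rewrite /C; nra.
  pose d := Num.min 1 (e%:num / (C + 1)).
  have d0 : 0 < d by rewrite lt_min ltr01 divr_gt0 //; lra.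
  apply: filterS (nbhs0_lt d0) => x.
  rewrite lt_min ltr_pdivlMr; last lra.
  move=> /andP[x1 xe].
  have -> : (rho \o shift z - (cst (rho z) + L)) x
      = 6 * q2 z x + 4 * q1 x z + rho x.
    have -> : (rho \o shift z - (cst (rho z) + L)) x
      = rho (z + x) - (rho z + 4 * q1 z x) by rewrite [z + x]addrC.
    by have := rE z x 1 1; rewrite !scale1r => ->; ring.
  have cx := cvx z x; have [z0 q20 r0] := convex_coefs_ge0 cx.
  have w0 := normr_ge0 x.
  have rx : rho x <= k ^+ 2 * `|x| ^+ 2.
    apply: le_trans (rk x) _; rewrite exprMn ler_wpM2l ?sqr_ge0 //.
    by rewrite expr2 ler_piMl ?sqr_ge0 // expr_le1 // ltW.
  have q2b : q2 z x <= Num.sqrt (rho z) * `|k| * `|x| ^+ 2.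
    apply: ler_of_sqr; first by rewrite !mulr_ge0 ?sqrtr_ge0 // sqr_ge0.
    apply: le_trans (convex_coefs_cs2 cx) _.
    rewrite -mulrA exprMn sqr_sqrtr // ler_wpM2l //.
    by rewrite exprMn real_normK ?num_real // -exprMn.
  have q1b t : t ^+ 2 = q1 x z ^+ 2 -> t <= (q2 z x + rho x) / 2.
    move=> te; apply: ler_of_sqr; first lra.
    have := convex_coefs_cs3 cx; have := sqr_ge0 (q2 z x - rho x); rewrite te; nra.
  have q1b1 := q1b _ erefl; have q1b2 := q1b _ (sqrrN (q1 x z)).
  apply: (@le_trans _ _ (C * `|x| ^+ 2)); first by rewrite ler_norml /C; nra.
  by rewrite expr2 mulrA ler_wpM2r //; nra.
rewrite -(_ : L h = 4 * q1 z h) // (@scalar_dot L) //.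
by congr dot; apply/rowP => i; rewrite !mxE dE.
Qed.

End EuclideanTheory.

(** An algebraic form of the limit t -> 0, used to derive first-order optimality conditions along
    segments. *)
Lemma affine_ge0 (R : realFieldType) (b M : R) :
  (forall t, 0 < t -> t <= 1 -> 0 <= b + t * M) -> 0 <= b.
Proof.
move=> h; rewrite leNgt; apply/negP => b0.
have M0 : 0 < M by have := h 1 ltr01 (lexx _); lra.
have d0 : 0 < M - b by lra.
have t0 : 0 < - b / (M - b) * 2^-1 by rewrite mulr_gt0 ?divr_gt0 //; lra.
have := h (- b / (M - b) * 2^-1) t0.
have t1 : - b / (M - b) <= 1 by rewrite ler_pdivrMr //; lra.
have tM : - b / (M - b) * M <= - b.
  by rewrite mulrAC ler_pdivrMr //; nra.
by move=> /(_ ltac:(lra)); lra.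
Qed.

(** * Geometry of g = sqrt rho and the accelerated inner loop *)

Section Inner.
Variables (R : realType) (n : nat).
Local Notation E := 'rV[R]_n.
Variables (B : {linear E -> E}) (K : set E) (c : E) (rho : E -> R).
Variables (alpha beta : R).
Hypotheses (Bs : self_adjoint B) (Bpos : positive_definite B).
Hypotheses (Kccc : closed_convex_cone K) (rc : convex_quartic_form rho).
Hypotheses (alpha0 : 0 < alpha) (ab : alpha <= beta).
Hypothesis rho_bounds : forall x, alpha ^+ 2 * enorm B x ^+ 4 <= rho x
  /\ rho x <= beta ^+ 2 * enorm B x ^+ 4.
Implicit Types x y z h u v : E.

Let F := hom_feasible K c.
Let g y := Num.sqrt (rho y).
(** Where rho z > 0, the derivative of g at z in direction h. *)
Let ell z h := (2 * Num.sqrt (rho z))^-1 * dot (grad rho z) h.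

Let beta0 : 0 < beta. Proof. exact: lt_le_trans ab. Qed.

Lemma quartic_form_gradient : exists q1 q2 : E -> E -> R,
  [/\ forall z, scalar (q1 z),
      quartic_polars rho q1 q2,
      forall z h, convex_coefs (rho z) (q1 z h) (q2 z h) (q1 h z) (rho h)
    & forall z h, dot (grad rho z) h = 4 * q1 z h].
Proof.
have [q1 [q2 [q1l rE]]] := quartic_form_binary rc.
have cvx := quartic_form_convex_coefs rc.1 rE.
exists q1, q2; split=> //.
have [m [M [m0 M0 mM]]] := enorm_sqr_bounds Bpos.
apply: (dot_grad (k := beta * M) q1l rE cvx) => h.
apply: le_trans (rho_bounds h).2 _; rewrite -mulrA exprMn.
rewrite ler_pM2l ?exprn_gt0 // -[enorm B h ^+ 4]/(enorm B h ^+ (2 * 2)) exprM.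
by rewrite ler_sqr ?nnegrE ?sqr_ge0 ?mulr_ge0 ?sqr_ge0 //; have [] := mM h.
Qed.

Lemma rho_ge0 x : 0 <= rho x.
Proof.
apply: le_trans (rho_bounds x).1; rewrite mulr_ge0 ?sqr_ge0 //.
by rewrite exprn_ge0 // sqrtr_ge0.
Qed.

Lemma rho_gt0 x : x != 0 -> 0 < rho x.
Proof.
move=> /Bpos x0; apply: lt_le_trans (rho_bounds x).1.
by rewrite mulr_gt0 ?exprn_gt0 // sqrtr_gt0.
Qed.

Lemma sqrt_rho_bounds x :
  alpha * enorm B x ^+ 2 <= g x /\ g x <= beta * enorm B x ^+ 2.
Proof.
have [h1 h2] := rho_bounds x; have x0 := sqr_ge0 (enorm B x).
have sq (k : R) : 0 <= k ->
    k * enorm B x ^+ 2 = Num.sqrt (k ^+ 2 * enorm B x ^+ 4).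
  move=> k0; rewrite -[_ ^+ 4]/(enorm B x ^+ (2 * 2)) exprM -exprMn sqrtr_sqr.
  by rewrite ger0_norm // mulr_ge0.
by split; rewrite sq ?ler_wsqrtr // ltW.
Qed.

Lemma hom_feasible_neq0 z : dot c z = 1 -> z != 0.
Proof. by apply: contra_eq_neq => ->; rewrite dot0r eq_sym oner_neq0. Qed.

Lemma hom_feasible_line x y t : F x -> F y -> 0 <= t -> t <= 1 ->
  F (x + t *: (y - x)).
Proof.
move=> [Kx cx] [Ky cy] t0 t1; have [_ Kc _] := Kccc; split.
  have -> : x + t *: (y - x) = t *: y + (1 - t) *: x.
    by rewrite scalerBr scalerBl scale1r addrC addrAC addrA.
  exact: convex_setP.
by rewrite dotDr dotZr dotBr cx cy subrr mulr0 addr0.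
Qed.

Lemma sqrt_rho_tangent z y : z != 0 -> g z + ell z (y - z) <= g y.
Proof.
move=> /rho_gt0 z0; have [q1 [q2 [q1l rE cvx gq]]] := quartic_form_gradient.
have g0 : 0 < g z by rewrite sqrtr_gt0.
(* Subtracting the expansions of rho (z + z) and rho (z - z), with rho (2 z) = 16 rho z and rho 0 =
   0, gives 16 [q1 z z] = 16 rho z. *)
have q1z : q1 z z = rho z.
  have := rE z z 1 1; have := rE z z 1 (- 1).
  rewrite !scale1r scaleN1r subrr => e1.
  have := rE 0 0 0 0; have := rE z z (1 + 1) 0; rewrite !scale0r !addr0 scalerDl !scale1r; lra.
have q1B : q1 z (y - z) = q1 z y - rho z.
  by have := q1l z (- 1) z y; rewrite scaleN1r (addrC (- z)) => ->; rewrite q1z /=; lra.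
have := sqrt_quartic_tangent (cvx z y) g0 (sqrtr_ge0 (rho y)).
rewrite !sqr_sqrtr ?rho_ge0 // => /(_ erefl erefl).
apply: le_trans; rewrite /ell gq q1B -/(g z).
have -> : rho z = g z ^+ 2 by rewrite sqr_sqrtr // ltW.
rewrite le_eqVlt; apply/orP; left; apply/eqP; field.
by rewrite gt_eqF.
Qed.

Lemma sqrt_rho_smooth z y : z != 0 ->
  g y <= g z + ell z (y - z) + 3 * beta * enorm B (y - z) ^+ 2.
Proof.
move=> /rho_gt0 z0; have [q1 [q2 [q1l rE cvx gq]]] := quartic_form_gradient.
have g0 : 0 < g z by rewrite sqrtr_gt0.
have := sqrt_quartic_smooth (cvx z (y - z)) g0 (sqrtr_ge0 (rho (y - z))).
rewrite (sqr_sqrtr (rho_ge0 z)) (sqr_sqrtr (rho_ge0 (y - z))) => /(_ erefl erefl).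
have := rE z (y - z) 1 1; rewrite !scale1r subrKC => yE.
have -> : rho z + 4 * q1 z (y - z) + 6 * q2 z (y - z) + 4 * q1 (y - z) z
  + rho (y - z) = rho y by rewrite yE; ring.
move=> h; apply: le_trans h _; rewrite /ell gq -/(g z).
have := (sqrt_rho_bounds (y - z)).2; rewrite /g.
have -> : (2 * g z)^-1 * (4 * q1 z (y - z)) = 2 * q1 z (y - z) / g z.
  by field; rewrite gt_eqF.
rewrite /g; lra.
Qed.

(** Minimality of [ystar] makes the linear term of rho at [ystar] nonnegative, and
    [quartic_uniformly_convex] bounds the remaining terms. *)
Lemma hom_minimizer_growth y ystar : minimizer_on F g ystar -> F y ->
  rho (y - ystar) / 3 <= rho y - rho ystar.
Proof.
move=> [Fs ms] Fy; have [q1 [q2 [q1l rE cvx gq]]] := quartic_form_gradient.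
have := cvx ystar (y - ystar); set h := y - ystar => cs.
have := rE ystar h 1 1; rewrite !scale1r subrKC => ->.
have q1_ge0 : 0 <= 4 * q1 ystar h.
  (* For 0 < t <= 1 the terms of order at least 2, divided by t, are at most t times this
     constant. *)
  apply: (@affine_ge0 _ _ (6 * q2 ystar h + 4 * `|q1 h ystar| + rho h)) => t t0 t1.
  have [_ q20 _] := convex_coefs_ge0 cs.
  have Ft := hom_feasible_line Fs Fy (ltW t0) t1.
  have := ms _ Ft; rewrite /g ler_sqrt ?rho_ge0 // -/h.
  have := rE ystar h 1 t; rewrite scale1r => -> {Ft}.
  rewrite !expr1n !mulr1 !mul1r => k.
  have k1 : 0 <= t * (4 * q1 ystar h + t * (6 * q2 ystar h)
     + t ^+ 2 * (4 * q1 h ystar) + t ^+ 3 * rho h) by move: k; lra.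
  rewrite pmulr_rge0 // in k1.
  have tt : t ^+ 2 <= t by nra.
  have ttt : t ^+ 3 <= t by rewrite exprS; nra.
  have r0 := rho_ge0 h; have := ler_norm (q1 h ystar).
  have := normr_ge0 (q1 h ystar).
  have : t ^+ 3 * rho h <= t * rho h by rewrite ler_wpM2r.
  have : t ^+ 2 * q1 h ystar <= t * `|q1 h ystar|.
    apply: (@le_trans _ _ (t ^+ 2 * `|q1 h ystar|)).
      by rewrite ler_wpM2l ?sqr_ge0 // ler_norm.
    by rewrite ler_wpM2r.
  lra.
have := quartic_uniformly_convex cs; rewrite !expr1n; lra.
Qed.

Lemma hom_minimizer_dist y ystar : minimizer_on F g ystar -> F y ->
  alpha * enorm B (y - ystar) ^+ 2 <= Num.sqrt (3 * (rho y - rho ystar)).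
Proof.
move=> ms Fy; apply: le_trans (sqrt_rho_bounds _).1 _.
by apply: ler_wsqrtr; have := hom_minimizer_growth ms Fy; lra.
Qed.

(** The model is a quadratic with leading part 3 beta ||.||^2, so by first-order optimality at u it
    exceeds its minimum by at least 3 beta ||y - u||^2. *)
Lemma pg_step_three_points z u y : pg_step B K c rho beta z u -> F y ->
  ell z (u - z) + 3 * beta * enorm B (u - z) ^+ 2
    + 3 * beta * enorm B (y - u) ^+ 2
  <= ell z (y - z) + 3 * beta * enorm B (y - z) ^+ 2.
Proof.
move=> [Fu mu] Fy.
have uzy : u - z + (y - u) = y - z by rewrite addrC subrKA.
have e2 : enorm B (y - z) ^+ 2 = enorm B (u - z) ^+ 2
    + 2 * dot (B (u - z)) (y - u) + enorm B (y - u) ^+ 2.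
  have := enorm_sqr_line Bs Bpos (u - z) (y - u) 1.
  by rewrite scale1r uzy => ->; ring.
have lE : ell z (y - z) = ell z (u - z) + ell z (y - u).
  by rewrite /ell -mulrDr -dotDr uzy.
suff : 0 <= ell z (y - u) + 6 * beta * dot (B (u - z)) (y - u).
  by rewrite lE e2; lra.
apply: (@affine_ge0 _ _ (3 * beta * enorm B (y - u) ^+ 2)) => t t0 t1.
rewrite -(pmulr_rge0 _ t0).
have := mu _ (hom_feasible_line Fu Fy (ltW t0) t1).
rewrite addrAC (enorm_sqr_line Bs Bpos) (dotDr _ (u - z)) dotZr /ell; lra.
Qed.

(** The comparison point is x = (1 - 1/t) a + (1/t) ystar. Smoothness bounds g u by the model, the
    three-point inequality passes to x, and the tangents at z bound its linear part by g a and g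
    ystar; the result is multiplied by t^2. *)
Lemma accelerated_step (t : R) z u a ystar : 1 <= t -> dot c z = 1 -> F ystar ->
  F a -> pg_step B K c rho beta z u ->
  t ^+ 2 * (g u - g ystar)
    + 3 * beta * enorm B (t *: u - (t - 1) *: a - ystar) ^+ 2
  <= (t ^+ 2 - t) * (g a - g ystar)
    + 3 * beta * enorm B (t *: z - (t - 1) *: a - ystar) ^+ 2.
Proof.
move=> t1 /hom_feasible_neq0 z0 Fs Fa pg.
have t0 : 0 < t by lra.
have tn : t != 0 by rewrite gt_eqF.
have ti0 : 0 <= t^-1 by rewrite invr_ge0 ltW.
have ti1 : t^-1 <= 1 by rewrite invf_le1.
pose x := a + t^-1 *: (ystar - a).
have Fx : F x := hom_feasible_line Fa Fs ti0 ti1.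
(* The vector on the left is - t (x - w). *)
have wE w : enorm B (t *: w - (t - 1) *: a - ystar) ^+ 2
    = t ^+ 2 * enorm B (x - w) ^+ 2.
  rewrite -[t ^+ 2]sqrrN -(enorm_sqrZ Bpos); congr (enorm B _ ^+ 2).
  by apply/rowP => i; rewrite !mxE; field.
have lx : ell z (x - z) = (1 - t^-1) * ell z (a - z) + t^-1 * ell z (ystar - z).
  by rewrite /ell /x !(dotBr, dotDr, dotZr); ring.
have h1 := sqrt_rho_smooth u z0; have h2 := pg_step_three_points pg Fx.
have h3 : (1 - t^-1) * (g z + ell z (a - z)) <= (1 - t^-1) * g a.
  by apply: ler_wpM2l; [lra|exact: sqrt_rho_tangent].
have h4 : t^-1 * (g z + ell z (ystar - z)) <= t^-1 * g ystar.
  by apply: ler_wpM2l; [lra|exact: sqrt_rho_tangent].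
rewrite !wE; have -> : t ^+ 2 - t = t ^+ 2 * (1 - t^-1) by field.
suff h : g u - g ystar + 3 * beta * enorm B (x - u) ^+ 2
    <= (1 - t^-1) * (g a - g ystar) + 3 * beta * enorm B (x - z) ^+ 2.
  have := ler_wpM2l (sqr_ge0 t) h; lra.
lra.
Qed.

(** The left side of [pot] is a potential that never increases along the loop and starts at most at
    3 beta ||y - ystar||^2. *)
Lemma inner_loop_rate N y v ystar : minimizer_on F g ystar -> F y -> (0 < N)%N ->
  inner_loop B K c rho beta N y v ->
  F v /\ N%:R ^+ 2 * (g v - g ystar) <= 12 * beta * enorm B (y - ystar) ^+ 2.
Proof.
move=> [Fs ms] Fy; case: N => // N _ [u [z [u0 z0 st ->]]].
have Fu k : (k <= N.+1)%N -> F (u k).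
  by case: k => [|k] kN; [rewrite u0|have [[]] := st _ kN].
(* Extrapolation may leave K but keeps [dot c (z k) = 1], hence z k != 0, as the smoothness and
   tangent bounds require. *)
have cz k : (k <= N)%N -> dot c (z k) = 1.
  case: k => [|k] kN; first by rewrite z0; have [] := Fy.
  have [_ ->] := st k (ltnW kN).
  have [_ c1] := Fu k.+1 (ltnW kN); have [_ c2] := Fu k (leqW (ltnW kN)).
  by rewrite dotDr dotZr dotBr c1 c2 subrr mulr0 addr0.
split; first exact: Fu.
(* The momentum k / (k + 3) is (t_k - 1) / t_(k+1), where t_k = (k + 2) / 2. *)
pose t k : R := (k.+2)%:R / 2.
have tS k : t k.+1 = t k + 1 / 2 by rewrite /t [k.+3%:R]mulrSr; field.
have tk k : k%:R = 2 * (t k - 1) by rewrite /t -(addn2 k) natrD; field.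
have t1 k : 1 <= t k by have := ler0n R k; rewrite tk; lra.
have pot k : (k <= N)%N -> t k ^+ 2 * (g (u k.+1) - g ystar)
    + 3 * beta * enorm B (t k *: u k.+1 - (t k - 1) *: u k - ystar) ^+ 2
    <= 3 * beta * enorm B (y - ystar) ^+ 2.
  elim: k => [_|k IH kN].
    have [pg _] := st 0 isT.
    have := accelerated_step (t1 0) (cz 0%N isT) Fs (Fu 0%N isT) pg.
    by rewrite u0 z0 /t divff ?pnatr_eq0 // expr1n !subrr mul0r scale0r subr0 !scale1r add0r subr0.
  have [pg _] := st k.+1 kN.
  apply: le_trans (accelerated_step (t1 k.+1) (cz _ kN) Fs (Fu k.+1 (leqW kN)) pg) _.
  apply: le_trans (IH (ltnW kN)); apply: lerD.
    apply: ler_wpM2r; first by rewrite subr_ge0 ms //; exact/Fu/leqW.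
    (* t_(k+1)^2 - t_(k+1) = t_k^2 - 1/4. *)
    by rewrite tS; have := t1 k; nra.
  have [_ ->] := st k (ltnW kN).
  rewrite le_eqVlt; apply/orP; left; apply/eqP; congr (_ * enorm B _ ^+ 2).
  apply/rowP => i; rewrite !mxE natrD tk tS; field.
  by have := t1 k; lra.
have := pot N (leqnn _).
have : 0 <= 3 * beta * enorm B (t N *: u N.+1 - (t N - 1) *: u N - ystar) ^+ 2.
  by rewrite mulr_ge0 ?sqr_ge0 // mulr_ge0 // ltW.
have : 0 <= g (u N.+1) - g ystar by rewrite subr_ge0 ms //; exact: Fu.
(* The number of steps is below 2 t_N, so its square is at most 4 t_N^2; this turns 3 beta into 12
   beta. *)
have -> : N.+1%:R = 2 * t N - 1 by rewrite [LHS]mulrSr (tk N); ring.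
have := t1 N; nra.
Qed.

End Inner.

(** * Existence of runs and the rate of the outer loop *)

Section Outer.
Variables (R : realType) (n : nat).
Local Notation E := 'rV[R]_n.
Variables (B : {linear E -> E}) (K : set E) (c : E) (rho : E -> R).
Variables (alpha beta : R).
Hypotheses (Bs : self_adjoint B) (Bpos : positive_definite B).
Hypotheses (Kccc : closed_convex_cone K) (rc : convex_quartic_form rho).
Hypotheses (alpha0 : 0 < alpha) (ab : alpha <= beta).
Hypothesis rho_bounds : forall x, alpha ^+ 2 * enorm B x ^+ 4 <= rho x
  /\ rho x <= beta ^+ 2 * enorm B x ^+ 4.
Implicit Types x y z h u v : E.

Let F := hom_feasible K c.
Let g y := Num.sqrt (rho y).

Lemma hom_feasible_closed : closed F.
Proof.
have [Kc _ _] := Kccc; apply: closedI => //.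
apply: (@closed_comp _ _ (dot c) [set t | t = 1]); last exact: closed_eq.
by move=> x _; exact: dot_continuous.
Qed.

Lemma pg_step_exists z : F !=set0 -> exists u, pg_step B K c rho beta z u.
Proof.
move=> F0; have b3 : 0 < 3 * beta by rewrite mulr_gt0 //; exact: lt_le_trans ab.
have [u mu] := quadratic_model_minimizer Bpos
  ((2 * Num.sqrt (rho z))^-1 *: grad rho z) z hom_feasible_closed F0 b3.
exists u; rewrite /pg_step; move: mu; congr (minimizer_on _ _ _).
by apply/funext => y; rewrite dotC dotZr dotC.
Qed.

Lemma inner_loop_exists N y : F !=set0 -> exists v, inner_loop B K c rho beta N y v.
Proof.
move=> F0; have [S HS] := choice (fun z => pg_step_exists z F0).
pose next k (p : E * E) : E * E :=
  (S p.2, S p.2 + (k%:R / (k + 3)%N%:R) *: (S p.2 - p.1)).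
pose w := nat_rect (fun=> (E * E)%type) (y, y) next.
by exists (w N).1, (fun k => (w k).1), (fun k => (w k).2); split.
Qed.

(** Makes the guarantee on all returned points non-vacuous. *)
Lemma ahgm_run_exists T y0 : F !=set0 -> exists w : nat -> E, ahgm_run B K c rho beta T y0 w.
Proof.
move=> F0.
have step (p : nat * E) : exists y', exists2 v,
    inner_loop B K c rho beta (2 ^ p.1)%N p.2 v & minimizer_on [set p.2; v] rho y'.
  have [v vP] := inner_loop_exists (2 ^ p.1)%N p.2 F0.
  have [le|/ltW le] := leP (rho p.2) (rho v).
    by exists p.2, v => //; split; [left|move=> _ [->|->]].
  by exists v, v => //; split; [right|move=> _ [->|->]].
have [S HS] := choice step.
exists (nat_rect (fun=> E) y0 (fun t y => S (t, y))); split => // t _.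
exact: HS (t, _).
Qed.

(** Induction on t. The new gap e' is bounded by a square root of the old gap e, so squares are
    compared: the N^4 gained from the loop and the N^4 in the hypothesis on e combine into N^8.
    Monotonicity of g along the run keeps 1 + e <= D. *)
Lemma ahgm_rate T y0 (y : nat -> E) ystar : minimizer_on F g ystar -> F y0 ->
  ahgm_run B K c rho beta T y0 y ->
  F (y T) /\ (g (y T) / g ystar - 1) * (2 ^+ T) ^+ 4
    <= 22 ^+ 4 * (beta / alpha) ^+ 2 * (g y0 / g ystar).
Proof.
move=> ms Fy0 [y_0 st]; have [Fs gs] := ms.
have beta0 : 0 < beta := lt_le_trans alpha0 ab.
have gs0 : 0 < g ystar.
  by rewrite sqrtr_gt0; apply: (rho_gt0 Bpos alpha0 rho_bounds); apply: hom_feasible_neq0 Fs.2.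
pose kappa := beta / alpha; pose D := 1 + (g y0 / g ystar - 1).
have kappa1 : 1 <= kappa by rewrite ler_pdivlMr // mul1r.
suff inv t : (t <= T)%N -> [/\ F (y t), g (y t) <= g y0 &
    (g (y t) / g ystar - 1) * (2 ^+ t) ^+ 4 <= 22 ^+ 4 * kappa ^+ 2 * D].
  by have [FT _] := inv T (leqnn T); rewrite /D subrKC.
have g01 : 1 <= g y0 / g ystar by rewrite ler_pdivlMr // mul1r gs.
elim: t => [_|t IH tT].
  rewrite y_0; split => //; rewrite expr0 expr1n mulr1.
  have : 1 <= kappa ^+ 2 by rewrite exprn_ege1.
  rewrite /D; nra.
have [Ft gt0 et] := IH (ltnW tT).
have [v vP [y'P y'm]] := st _ tT.
have N0 : (0 < 2 ^ t)%N by rewrite expn_gt0.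
have [Fv rate] := inner_loop_rate Bs Bpos Kccc rc alpha0 ab rho_bounds ms Ft
  N0 vP.
have gy'y : g (y t.+1) <= g (y t) by apply: ler_wsqrtr; apply: y'm; left.
have gy'v : g (y t.+1) <= g v by apply: ler_wsqrtr; apply: y'm; right.
have Fy' : F (y t.+1) by case: y'P => ->.
split => //; first exact: le_trans gy'y gt0.
have dist := hom_minimizer_dist Bpos Kccc rc alpha0 ab rho_bounds ms Ft.
pose e := g (y t) / g ystar - 1; pose e' := g (y t.+1) / g ystar - 1.
pose N : R := 2 ^+ t.
have N1 : 1 <= N by rewrite exprn_ege1 // ler1n.
have N_gt0 : 0 < N by lra.
have eE : g (y t) = g ystar * (1 + e) by rewrite /e; field; rewrite gt_eqF.
have e'E : g (y t.+1) = g ystar * (1 + e') by rewrite /e'; field; rewrite gt_eqF.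
have e0 : 0 <= e by rewrite subr_ge0 ler_pdivlMr // mul1r gs.
have e'0 : 0 <= e' by rewrite subr_ge0 ler_pdivlMr // mul1r gs.
have eD : 1 + e <= D by rewrite lerD2l lerD2r ler_pM2r ?invr_gt0.
pose q := Num.sqrt (3 * (e * (2 + e))).
have q0 : 0 <= q := sqrtr_ge0 _.
have q2 : q ^+ 2 = 3 * (e * (2 + e)) by rewrite sqr_sqrtr //; nra.
have distE : Num.sqrt (3 * (rho (y t) - rho ystar)) = g ystar * q.
  have r x : rho x = g x ^+ 2 by rewrite sqr_sqrtr // (rho_ge0 rho_bounds).
  have -> : 3 * (rho (y t) - rho ystar) = g ystar ^+ 2 * (3 * (e * (2 + e))).
    by rewrite !r eE; ring.
  by rewrite sqrtrM ?sqr_ge0 // sqrtr_sqr gtr0_norm.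
rewrite distE in dist.
have main : N ^+ 2 * e' <= 12 * kappa * q.
  have h : enorm B (y t - ystar) ^+ 2 <= g ystar * q / alpha.
    by rewrite ler_pdivlMr // mulrC.
  have h1 : N ^+ 2 * (g ystar * e') <= 12 * beta * (g ystar * q / alpha).
    apply: le_trans (_ : N ^+ 2 * (g v - g ystar) <= _).
      by rewrite ler_wpM2l ?sqr_ge0 //; move: gy'v; rewrite e'E; lra.
    rewrite natrX in rate; apply: le_trans rate _.
    by rewrite ler_wpM2l // mulr_ge0 // ltW.
  rewrite -(ler_pM2l gs0) /kappa.
  have -> : g ystar * (12 * (beta / alpha) * q) = 12 * beta * (g ystar * q / alpha)
    by ring.
  by apply: le_trans h1; rewrite mulrCA.
rewrite -/e' [2 ^+ t.+1]exprSr -/N; rewrite -/e -/N in et.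
have [M0 D1] : 0 <= 22 ^+ 4 * kappa ^+ 2 * D /\ 1 <= D.
  have D1 : 1 <= D by rewrite /D; lra.
  by split=> //; have := mulr_ge0 (sqr_ge0 kappa) (le_trans ler01 D1); lra.
(* 864 = 12^2 * 3 * 2 comes from [main] and [2 + e <= 2 D]; the constant 22 is
   chosen so that 256 * 864 <= 22^4. *)
apply: ler_of_sqr => //.
have s1 : (N ^+ 2 * e') ^+ 2 <= (12 * kappa * q) ^+ 2.
  rewrite ler_sqr ?nnegrE //; first by rewrite mulr_ge0 ?sqr_ge0.
  by rewrite mulr_ge0 //; lra.
have s2 : (12 * kappa * q) ^+ 2 <= 864 * kappa ^+ 2 * D * e.
  rewrite exprMn q2; have := mulr_ge0 (sqr_ge0 kappa) e0; nra.
have s3 : N ^+ 4 * (864 * kappa ^+ 2 * D * e)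
    <= 864 * kappa ^+ 2 * D * (22 ^+ 4 * kappa ^+ 2 * D).
  have kD : 0 <= 864 * kappa ^+ 2 * D by lra.
  by have := ler_wpM2l kD et; lra.
have -> : (e' * (N * 2) ^+ 4) ^+ 2 = 256 * (N ^+ 4 * (N ^+ 2 * e') ^+ 2) by ring.
have s4 : N ^+ 4 * (N ^+ 2 * e') ^+ 2
    <= 864 * kappa ^+ 2 * D * (22 ^+ 4 * kappa ^+ 2 * D).
  apply: le_trans s3; apply: ler_wpM2l; last exact: le_trans s1 s2.
  by rewrite exprn_ge0 // ltW.
have := sqr_ge0 (kappa ^+ 2 * D); move: s4; lra.
Qed.

(** * From the homogenized problem back to f *)

Lemma rhoZ s x : rho (s *: x) = s ^+ 4 * rho x.
Proof.
have [q1 [q2 [_ rE]]] := quartic_form_binary rc.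
by have := rE x x s 0; rewrite scale0r addr0 => ->; ring.
Qed.

(** For [dot c y = 1] and rho y > 0, the minimizer over s >= 0 of s^4 rho y - s, the value of f
    along the ray of y. *)
Let scale y := ((4 * rho y) `^ (1 / 3))^-1.

Lemma scaleP y : 0 < rho y -> 0 < scale y /\ 4 * rho y * scale y ^+ 3 = 1.
Proof.
move=> r0; have r40 : 0 < 4 * rho y by rewrite mulr_gt0.
split; first by rewrite invr_gt0 powR_gt0.
rewrite /scale exprVn -powR_mulrn ?powR_ge0 // -powRrM.
have -> : 1 / 3 * 3%:R = 1 :> R by field.
by rewrite powRr1 ?ltW // mulfV // gt_eqF.
Qed.

Let f x := rho x - dot c x.

Lemma hom_value y : F y -> 0 < rho y -> f (scale y *: y) = - (3 / 4) * scale y.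
Proof.
move=> [_ cy] /scaleP [s0 s3]; rewrite /f rhoZ dotZr cy.
have -> : scale y ^+ 4 * rho y = (4 * rho y * scale y ^+ 3) * scale y / 4 by field.
by rewrite s3; field.
Qed.

(** The rescaled [ystar] lies in K, which gives one inequality. Conversely, if t = <c, xstar> > 0,
    then xstar / t is feasible for the homogenized problem and f xstar >= t^4 rho ystar - t; if t <=
    0, then f xstar >= 0. *)
Lemma minimum_value xstar ystar : minimizer_on K f xstar -> minimizer_on F g ystar ->
  f xstar = - (3 / 4) * scale ystar.
Proof.
move=> [Kx mx] [Fs ms].
have pos y : F y -> 0 < rho y.
  by move=> [_ /hom_feasible_neq0 /(rho_gt0 Bpos alpha0 rho_bounds)].
have [s0 s3] := scaleP (pos _ Fs); have [Kc Kcv KZ] := Kccc.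
apply/eqP; rewrite eq_le -{1}(hom_value Fs (pos _ Fs)) mx /=; last first.
  by apply: KZ => //; have [] := Fs.
have [cx|cx] := leP (dot c xstar) 0.
  by have := rho_ge0 rho_bounds xstar; rewrite /f; lra.
set t := dot c xstar in cx; set s := scale ystar in s0 s3 *.
have Fx : F (t^-1 *: xstar).
  by split; [apply: KZ; rewrite ?invr_gt0|rewrite dotZr mulVf // gt_eqF].
have xE : xstar = t *: (t^-1 *: xstar) by rewrite scalerA divff ?gt_eqF // scale1r.
have rx : t ^+ 4 * rho ystar <= rho xstar.
  rewrite {1}xE rhoZ ler_pM2l ?exprn_gt0 //.
  by have := ms _ Fx; rewrite /g ler_sqrt // ltW // pos.
have -> : f xstar = rho xstar - t by [].
apply: le_trans (_ : t ^+ 4 * rho ystar - t <= _); last by rewrite lerD2r.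
have rs : rho ystar = (4 * s ^+ 3)^-1.
  have s30 : s ^+ 3 != 0 by rewrite expf_neq0 // gt_eqF.
  by apply: (mulIf s30); apply: (@mulfI _ 4) => //; rewrite mulrA s3; field; rewrite gt_eqF.
rewrite rs -subr_ge0.
(* t^4 - 4 s^3 t + 3 s^4 has the double root t = s. *)
have -> : t ^+ 4 * (4 * s ^+ 3)^-1 - t - - (3 / 4) * s =
  (4 * s ^+ 3)^-1 * ((t - s) ^+ 2 * (t ^+ 2 + 2 * t * s + 3 * s ^+ 2)).
  by field; rewrite gt_eqF.
apply: mulr_ge0; first by rewrite invr_ge0 mulr_ge0 // exprn_ge0 // ltW.
apply: mulr_ge0; first exact: sqr_ge0.
by have := mulr_gt0 cx s0; have := sqr_ge0 t; have := sqr_ge0 s; lra.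
Qed.

(** The gap is 1 - w with w = (1 + e)^(-2/3), handled through w^3 (1 + e)^2 = 1. If w < 1 - e, this
    product would be below (1 - e) (1 - e^2)^2 <= 1. *)
Lemma hom_relative_gap xstar ystar y : minimizer_on K f xstar ->
  minimizer_on F g ystar -> F y ->
  (f (scale y *: y) - f xstar) / `|f xstar| <= g y / g ystar - 1.
Proof.
move=> mx ms Fy; have [Fs gs] := ms.
have pos x : F x -> 0 < rho x.
  by move=> [_ /hom_feasible_neq0 /(rho_gt0 Bpos alpha0 rho_bounds)].
rewrite (hom_value Fy (pos _ Fy)) (minimum_value mx ms).
have [s0 s3] := scaleP (pos _ Fs); have [t0 t3] := scaleP (pos _ Fy).
set s := scale ystar in s0 s3 *; set t := scale y in t0 t3 *.
have -> : `| - (3 / 4) * s| = 3 / 4 * s by rewrite mulNr normrN gtr0_norm // mulr_gt0.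
have gs0 : 0 < g ystar by rewrite sqrtr_gt0 pos.
pose e := g y / g ystar - 1; rewrite -/e.
have e0 : 0 <= e by rewrite subr_ge0 ler_pdivlMr // mul1r gs.
pose w := t / s.
have w0 : 0 < w by rewrite divr_gt0.
have -> : (- (3 / 4) * t - - (3 / 4) * s) / (3 / 4 * s) = 1 - w.
  by rewrite /w; field; rewrite gt_eqF.
have w3 : w ^+ 3 * (1 + e) ^+ 2 = 1.
  rewrite /e subrKC /w !expr_div_n !sqr_sqrtr ?ltW ?pos //.
  have s30 : s ^+ 3 != 0 by rewrite expf_neq0 // gt_eqF.
  have r0 : rho ystar != 0 by rewrite gt_eqF // pos.
  have -> : t ^+ 3 / s ^+ 3 * (rho y / rho ystar)
    = (4 * rho y * t ^+ 3) / (4 * rho ystar * s ^+ 3) by field; rewrite r0 gt_eqF.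
  by rewrite s3 t3 divr1.
rewrite leNgt; apply/negP => we.
have w1 : w < 1 - e by lra.
have e1 : e < 1 by lra.
have h1 : w ^+ 3 < (1 - e) ^+ 3 by rewrite ltr_pXn2r ?nnegrE //; lra.
have h2 : w ^+ 3 * (1 + e) ^+ 2 < (1 - e) ^+ 3 * (1 + e) ^+ 2.
  by rewrite ltr_pM2r // exprn_gt0 //; lra.
have h3 : (1 - e) ^+ 3 * (1 + e) ^+ 2 = (1 - e) * (1 - e ^+ 2) ^+ 2 by ring.
have h4 : (1 - e ^+ 2) ^+ 2 <= 1.
  by rewrite expr_le1 //; nra.
have : (1 - e) * (1 - e ^+ 2) ^+ 2 <= 1 * 1 by rewrite ler_pM ?sqr_ge0 //; lra.
lra.
Qed.

End Outer.

(** * Counting projected gradient steps, and the complexity bound *)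

Lemma pg_steps_pred T : (pg_steps T).+1 = (2 ^ T)%N.
Proof.
rewrite /pg_steps; elim: T => [|T IH]; first by rewrite big_ord0.
by rewrite big_ord_recr /= -addSn IH expnS mul2n addnn.
Qed.

(** The least T with Y <= 2^T satisfies 2^T < 2 Y unless T = 0, in which case no step is made. *)
Lemma pow2_tight (R : realType) (Y : R) : 0 <= Y ->
  exists2 T : nat, Y <= 2 ^+ T & (pg_steps T)%:R <= 2 * Y.
Proof.
move=> Y0; have ex : exists T, Y <= 2 ^+ T.
  exists (Num.trunc Y).+1; apply: le_trans (ltW (truncnS_gt Y)) _.
  by rewrite -natrX ler_nat ltnW // ltn_expl.
case: (ex_minnP ex) => T YT Tmin; exists T => //.
case: T YT Tmin => [|T] _ Tmin; first by rewrite /pg_steps big_ord0 mulr_ge0.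
have YT : 2 ^+ T < Y by rewrite ltNge; apply/negP => /Tmin; rewrite ltnn.
apply: (@le_trans _ _ (2 ^+ T.+1)); last by rewrite exprS ler_pM2l // ltW.
by rewrite -natrX ler_nat -pg_steps_pred.
Qed.

(** [C] is quantified before the dimension and all data, so it is absolute. The guarantee covers
    every returned point, whatever the tie-breaking. *)
Theorem theorem4p7 (R : realType) :
  exists2 C : R, 0 < C &
    forall (n : nat) (B : {linear 'rV[R]_n -> 'rV[R]_n}) (K : set 'rV[R]_n)
      (c : 'rV[R]_n) (rho : 'rV[R]_n -> R) (alpha beta : R)
      (xstar ystar y0 : 'rV[R]_n) (delta : R),
    let f := fun x : 'rV[R]_n => rho x - dot c x in
    let kappa := beta / alpha in
    let delta0 := Num.sqrt (rho y0 / rho ystar) - 1 in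
    self_adjoint B -> positive_definite B ->
    closed_convex_cone K ->
    c != 0 -> (exists2 x, K x & 0 < dot c x) ->
    convex_quartic_form rho ->
    0 < alpha -> alpha <= beta ->
    (forall x, alpha ^+ 2 * enorm B x ^+ 4 <= rho x
               /\ rho x <= beta ^+ 2 * enorm B x ^+ 4) ->
    minimizer_on K f xstar ->
    minimizer_on (hom_feasible K c) (fun y => Num.sqrt (rho y)) ystar ->
    hom_feasible K c y0 ->
    0 < delta ->
    exists T : nat,
      [/\ (pg_steps T)%:R <=
            C * (Num.sqrt kappa / delta `^ (1 / 4) * (1 + delta0 `^ (1 / 4))),
          exists x, ahgm_returns B K c rho beta T y0 x
        & forall x, ahgm_returns B K c rho beta T y0 x ->
            (f x - f xstar) / `|f xstar| <= delta].
Proof.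
(* 44 = 2 * 22: the 22 comes from [ahgm_rate], the 2 from rounding up to a power of two. *)
exists 44 => // n B K c rho alpha beta xstar ystar y0 delta f kappa delta0.
move=> Bs Bpos Kccc _ _ rc alpha0 ab rho_bounds mx ms Fy0 delta_gt0.
have rpos x : dot c x = 1 -> 0 < rho x.
  by move=> /hom_feasible_neq0 /(rho_gt0 Bpos alpha0 rho_bounds).
have [Fs gs] := ms.
have s0 : 0 < Num.sqrt (rho ystar) by rewrite sqrtr_gt0 rpos // Fs.2.
have ratioE : Num.sqrt (rho y0 / rho ystar) = Num.sqrt (rho y0) / Num.sqrt (rho ystar).
  by rewrite sqrtrM ?sqrtrV // ltW // rpos // ?Fy0.2 ?Fs.2.
have delta0_ge0 : 0 <= delta0.
  by rewrite subr_ge0 ratioE ler_pdivlMr // mul1r gs.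
have root4 (x : R) : 0 <= x -> (x `^ (1 / 4)) ^+ 4 = x.
  move=> x0; rewrite -powR_mulrn ?powR_ge0 // -powRrM.
  by rewrite (_ : 1 / 4 * 4%:R = 1 :> R) ?powRr1 //; field.
pose p := delta0 `^ (1 / 4); pose d := delta `^ (1 / 4).
have p0 : 0 <= p := powR_ge0 _ _.
have d0 : 0 < d by rewrite powR_gt0.
have p4 : p ^+ 4 = delta0 := root4 _ delta0_ge0.
have d4 : d ^+ 4 = delta := root4 _ (ltW delta_gt0).
have kappa0 : 0 < kappa by rewrite divr_gt0 //; exact: lt_le_trans ab.
(* With this Y, 2^T >= Y makes the bound of [ahgm_rate] at most delta. *)
pose Y := 22 * (Num.sqrt kappa / d * (1 + p)).
have Y0 : 0 <= Y.
  apply: mulr_ge0 => //; apply: mulr_ge0; last exact: addr_ge0.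
  by apply: divr_ge0; [exact: sqrtr_ge0|exact: ltW].
have [T YT TY] := pow2_tight Y0; exists T; split.
- by apply: le_trans TY _; rewrite -/p -/d /Y; lra.
- have [y yP] := ahgm_run_exists rho Bpos Kccc alpha0 ab T y0 (ex_intro _ _ Fy0).
  by exists (((4 * rho (y T)) `^ (1 / 3))^-1 *: y T), y.
move=> _ [y yP ->].
have [FT rate] := ahgm_rate Bs Bpos Kccc rc alpha0 ab rho_bounds ms Fy0 yP.
apply: le_trans (hom_relative_gap Bpos Kccc rc alpha0 rho_bounds mx ms FT) _.
have P0 : 0 < (2 ^+ T : R) ^+ 4 by rewrite !exprn_gt0.
rewrite -(ler_pM2r P0); apply: le_trans rate _.
apply: (@le_trans _ _ (delta * Y ^+ 4)); last first.
  by rewrite ler_pM2l // lerXn2r ?nnegrE // exprn_ge0.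
have -> : Num.sqrt (rho y0) / Num.sqrt (rho ystar) = 1 + p ^+ 4.
  by rewrite p4 -ratioE /delta0 subrKC.
have -> : delta * Y ^+ 4 = 22 ^+ 4 * kappa ^+ 2 * (1 + p) ^+ 4.
  rewrite -d4 /Y -{2}(sqr_sqrtr (ltW kappa0)); field; by rewrite gt_eqF.
apply: ler_wpM2l; first by rewrite mulr_ge0 ?sqr_ge0.
(* 1 + p^4 <= (1 + p)^4 for p >= 0, where p^4 = delta0. *)
have := mulr_ge0 p0 p0; have := mulr_ge0 p0 (mulr_ge0 p0 p0); lra.
Qed.
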